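(* Let $\mathfrak{L}$ be a left Leibniz algebra over a field $\mathbb{F}$. Then the category $\mathbf{Mod}^{\mathrm{bi}}_{\mathrm{weak}}(\mathfrak{L})$ of weak $\mathfrak{L}$-bimodules (with tensor product $M\otimes N$ as described in the context) is a symmetric monoidal category.
   Context: A left Leibniz algebra is an $\mathbb{F}$-vector space $\mathfrak{L}$ with a bilinear multiplication satisfying $x(yz)=(xy)z+y(xz)$ for all $x,y,z\in\mathfrak{L}$. A weak $\mathfrak{L}$-bimodule is an $\mathbb{F}$-vector space $M$ with bilinear left and right $\mathfrak{L}$-actions satisfying, for all $x,y\in\mathfrak{L}$, $m\in M$: (LLM) $(xy)\cdot m=x\cdot(y\cdot m)-y\cdot(x\cdot m)$ and (LML) $(x\cdot m)\cdot y=x\cdot(m\cdot y)-m\cdot(xy)$. Morphisms are $\mathbb{F}$-linear maps commuting with both actions. The tensor product of weak $\mathfrak{L}$-bimodules is the tensor product $M\otimes N$ over $\mathbb{F}$ with actions $x\cdot(m\otimes n):=(x\cdot m)\otimes n+m\otimes(x\cdot n)$ and $(m\otimes n)\cdot x:=(m\cdot x)\otimes n+m\otimes(n\cdot x)$; the unit object is $\mathbb{F}$ with trivial (zero) left and right actions; the associativity, commutativity (flip $m\otimes n\mapsto n\otimes m$) and left and right unit constraints are those of the category of $\mathbb{F}$-vector spaces. *)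

(* Defs.v *)
From HB Require Import structures.
From mathcomp Require Import all_boot all_order all_algebra.
From mathcomp Require Import generic_quotient ring_quotient sesquilinear.
From mathcomp Require Import freeg.
From mathcomp Require Import boolp.

Set Implicit Arguments.
Unset Strict Implicit.
Unset Printing Implicit Defensive.

Import GRing.Theory.
Local Open Scope ring_scope.
Local Open Scope quotient_scope.

Record category := Category {
  Obj :> Type;
  Hom : Obj -> Obj -> Type;
  idm : forall A, Hom A A;
  compm : forall A B C, Hom B C -> Hom A B -> Hom A C;
  comp1m : forall A B (f : Hom A B), compm (idm B) f = f;
  compm1 : forall A B (f : Hom A B), compm f (idm A) = f;
  compmA : forall A B C D (h : Hom C D) (g : Hom B C) (f : Hom A B),
    compm h (compm g f) = compm (compm h g) f }.

Arguments Hom {c} A B.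
Arguments idm {c} A.
Arguments compm {c A B C} g f.

Declare Scope cat_scope.
Delimit Scope cat_scope with cat.
Notation "f \; g" := (compm g f) : cat_scope.

Definition is_iso (C : category) (A B : C) (f : Hom A B) : Prop :=
  exists g : Hom B A, compm g f = idm A /\ compm f g = idm B.

Record sym_monoidal_data (C : category) := SymMonoidalData {
  tensO : C -> C -> C;
  tensH : forall A A' B B' : C,
    Hom A A' -> Hom B B' -> Hom (tensO A B) (tensO A' B');
  unitO : C;
  assoc : forall A B D : C, Hom (tensO (tensO A B) D) (tensO A (tensO B D));
  lunit : forall A : C, Hom (tensO unitO A) A;
  runit : forall A : C, Hom (tensO A unitO) A;
  braid : forall A B : C, Hom (tensO A B) (tensO B A) }.

Arguments tensO {C} s A B.
Arguments tensH {C} s {A A' B B'} f g.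
Arguments unitO {C} s.
Arguments assoc {C} s A B D.
Arguments lunit {C} s A.
Arguments runit {C} s A.
Arguments braid {C} s A B.

Section SymmetricMonoidal.
Variables (C : category) (S : sym_monoidal_data C).
Local Open Scope cat_scope.
Local Notation "A * B" := (tensO S A B) : cat_scope.
Local Notation "f ** g" := (tensH S f g) (at level 40) : cat_scope.
Local Notation I := (unitO S).
Local Notation a := (assoc S).
Local Notation l := (lunit S).
Local Notation r := (runit S).
Local Notation c := (braid S).

(* f \; g is composition in diagrammatic order: first f, then g. The second
   hexagon follows from hexagon and braid_sym. *)
Record is_symmetric_monoidal : Prop := IsSymmetricMonoidal {
  tensH_id : forall A B : C, idm A ** idm B = idm (A * B);
  tensH_comp : forall (A A' A'' B B' B'' : C)
      (f : Hom A A') (f' : Hom A' A'') (g : Hom B B') (g' : Hom B' B''),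
    (f \; f') ** (g \; g') = (f ** g) \; (f' ** g');
  assoc_nat : forall (A A' B B' D D' : C)
      (f : Hom A A') (g : Hom B B') (h : Hom D D'),
    ((f ** g) ** h) \; a A' B' D' = a A B D \; (f ** (g ** h));
  lunit_nat : forall (A A' : C) (f : Hom A A'),
    (idm I ** f) \; l A' = l A \; f;
  runit_nat : forall (A A' : C) (f : Hom A A'),
    (f ** idm I) \; r A' = r A \; f;
  braid_nat : forall (A A' B B' : C) (f : Hom A A') (g : Hom B B'),
    (f ** g) \; c A' B' = c A B \; (g ** f);
  assoc_iso : forall A B D : C, is_iso (a A B D);
  lunit_iso : forall A : C, is_iso (l A);
  runit_iso : forall A : C, is_iso (r A);
  pentagon : forall A B D E : C,
    a (A * B) D E \; a A B (D * E) =
    (a A B D ** idm E) \; (a A (B * D) E \; (idm A ** a B D E));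
  triangle : forall A B : C,
    a A I B \; (idm A ** l B) = r A ** idm B;
  hexagon : forall A B D : C,
    a A B D \; (c A (B * D) \; a B D A) =
    (c A B ** idm D) \; (a B A D \; (idm B ** c A D));
  braid_sym : forall A B : C, c A B \; c B A = idm (A * B) }.

End SymmetricMonoidal.

Section TensorProduct.
Variable F : fieldType.

Section Construction.
Variables M N : lmodType F.

Local Notation free := {freeg (M * N)%type / F}.
Local Notation "<[ m , n ]>" := (<< (m, n) >> : free).

(* the subspace of the free vector space on M * N spanned by the bilinearity
   relations *)
Inductive tens_null : free -> Prop :=
| tens_null0 : tens_null 0
| tens_nullP k u v : tens_null u -> tens_null v -> tens_null (k *: u + v)
| tens_nullL k m m' n :
    tens_null (<[k *: m + m', n]> - (k *: <[m, n]> + <[m', n]>))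
| tens_nullR k m n n' :
    tens_null (<[m, k *: n + n']> - (k *: <[m, n]> + <[m, n']>)).

Definition tens_nullb : {pred free} := fun u => `[< tens_null u >].

Lemma tens_nullb_closed : submod_closed tens_nullb.
Proof.
split=> [|k u v /asboolP hu /asboolP hv]; apply/asboolP; first exact: tens_null0.
exact: tens_nullP.
Qed.

HB.instance Definition _ :=
  GRing.isSubmodClosed.Build F free tens_nullb tens_nullb_closed.

Definition tens : Type := Quotient.quot tens_nullb.

HB.instance Definition _ := GRing.Zmodule.on tens.

Definition tens_pi (u : free) : tens := \pi_(Quotient.quot tens_nullb) u.

Lemma tens_pi_surj (t : tens) : exists u, t = tens_pi u.
Proof. by exists (repr t); rewrite /tens_pi reprK. Qed.

Lemma tens_piP u v : (tens_pi u = tens_pi v) <-> tens_null (u - v).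
Proof.
split=> [/eqP|h]; first by rewrite -Quotient.idealrBE => /asboolP.
by apply/eqP; rewrite -Quotient.idealrBE; apply/asboolP.
Qed.

Lemma tens_piD u v : tens_pi (u + v) = tens_pi u + tens_pi v.
Proof. exact: (raddfD (\pi_(Quotient.quot tens_nullb))). Qed.

Definition tens_scale (k : F) (t : tens) : tens := tens_pi (k *: repr t).

Lemma tens_piZ k u : tens_pi (k *: u) = tens_scale k (tens_pi u).
Proof.
apply/tens_piP; rewrite -scalerBr -[_ *: _]addr0.
apply: tens_nullP; last exact: tens_null0.
by apply/tens_piP; rewrite {2}/tens_pi reprK.
Qed.

Lemma tens_scaleA k k' t :
  tens_scale k (tens_scale k' t) = tens_scale (k * k') t.
Proof. by have [u ->] := tens_pi_surj t; rewrite -!tens_piZ scalerA. Qed.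

Lemma tens_scale1 : left_id 1 tens_scale.
Proof. by move=> t; have [u ->] := tens_pi_surj t; rewrite -tens_piZ scale1r. Qed.

Lemma tens_scaleDr : right_distributive tens_scale +%R.
Proof.
move=> k t t'; have [[u ->] [v ->]] := (tens_pi_surj t, tens_pi_surj t').
by rewrite -tens_piD -!tens_piZ scalerDr tens_piD.
Qed.

Lemma tens_scaleDl t : {morph tens_scale^~ t : k k' / k + k'}.
Proof.
move=> k k'; have [u ->] := tens_pi_surj t.
by rewrite -!tens_piZ scalerDl tens_piD.
Qed.

HB.instance Definition _ := GRing.Zmodule_isLmodule.Build F tens
  tens_scaleA tens_scale1 tens_scaleDr tens_scaleDl.

Definition tmul (m : M) (n : N) : tens := tens_pi <[m, n]>.

Lemma tens_pi_linear : linear tens_pi.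
Proof. by move=> k u v; rewrite tens_piD tens_piZ. Qed.

Lemma tmul_bilinear : bilinear_for *:%R *:%R tmul.
Proof.
split=> [n k m m'|m k n n']; rewrite /tmul -tens_pi_linear; apply/tens_piP.
  exact: tens_nullL.
exact: tens_nullR.
Qed.

(* Total in f; meaningful only for a bilinear f, where the value does not depend
   on the chosen representative of t and tens_lift f is the linear map induced
   by f (tens_lift_linear, tens_liftE, tens_hom_ext). *)
Definition tens_lift (P : lmodType F) (f : M -> N -> P) (t : tens) : P :=
  fglift (fun mn : M * N => f mn.1 mn.2) (repr t : free).

Section Lift.
Variables (P : lmodType F) (f : M -> N -> P).
Hypothesis bilf : bilinear_for *:%R *:%R f.

Let phi : free -> P := fglift (fun mn : M * N => f mn.1 mn.2).

HB.instance Definition _ := GRing.isZmodMorphism.Build free P phi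
  (lift_is_additive (fun mn : M * N => f mn.1 mn.2)).

Let phiZ k u : phi (k *: u) = k *: phi u.
Proof.
rewrite -[u in RHS]freeg_sumE [k *: u]/(fgscale k u) /fgscale.
rewrite !raddf_sum; apply: eq_bigr => x _ /=.
by rewrite /phi !liftU scalerA.
Qed.

Let phi1 m n : phi <[m, n]> = f m n.
Proof. by rewrite /phi liftU scale1r. Qed.

Let phi_null u : tens_null u -> phi u = 0.
Proof.
elim=> [|k {}u v _ hu _ hv|k m m' n|k m n n'].
- exact: raddf0.
- by rewrite raddfD /= phiZ hu hv scaler0 addr0.
- by rewrite raddfB raddfD /= phiZ !phi1 bilf.1 subrr.
- by rewrite raddfB raddfD /= phiZ !phi1 bilf.2 subrr.
Qed.

Lemma tens_lift_pi u : tens_lift f (tens_pi u) = phi u.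
Proof.
apply/eqP; rewrite /tens_lift -/phi -subr_eq0 -raddfB; apply/eqP/phi_null.
by apply/tens_piP; rewrite /tens_pi reprK.
Qed.

Lemma tens_lift_linear : linear (tens_lift f).
Proof.
move=> k t t'; have [[u ->] [v ->]] := (tens_pi_surj t, tens_pi_surj t').
by rewrite -tens_pi_linear !tens_lift_pi raddfD /= phiZ.
Qed.

Lemma tens_liftE m n : tens_lift f (tmul m n) = f m n.
Proof. by rewrite /tmul tens_lift_pi phi1. Qed.

End Lift.

Lemma tens_hom_ext (P : lmodType F) (g h : tens -> P) :
  linear g -> linear h -> (forall m n, g (tmul m n) = h (tmul m n)) -> g =1 h.
Proof.
move=> lg lh gh t; have [u ->] := tens_pi_surj t.
pose gm := GRing.isLinear.Build F tens P *:%R g lg.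
pose hm := GRing.isLinear.Build F tens P *:%R h lh.
pose gL : {linear tens -> P} := HB.pack g gm.
pose hL : {linear tens -> P} := HB.pack h hm.
pose pm := GRing.isLinear.Build F free tens *:%R tens_pi tens_pi_linear.
pose pL : {linear free -> tens} := HB.pack tens_pi pm.
have -> : u = \sum_(x <- dom u) coeff x u *: <[x.1, x.2]>.
  rewrite -[LHS]freeg_sumE; apply: eq_bigr => -[m n] _.
  apply/eqP/freeg_eqP => z; rewrite coeffZ !coeffU mul1r //.
rewrite -[g _]/(gL (pL _)) -[h _]/(hL (pL _)) !linear_sum /=.
apply: eq_bigr => -[m n] _.
by rewrite -[g _]/(gL (pL _)) -[h _]/(hL (pL _)) !linearZ /= [g _]gh.
Qed.

End Construction.

Definition tens_map (M M' N N' : lmodType F) (f : M -> M') (g : N -> N') :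
  tens M N -> tens M' N' := tens_lift (fun m n => tmul (f m) (g n)).

Definition tens_assoc (M N P : lmodType F) :
  tens (tens M N) P -> tens M (tens N P) :=
  tens_lift (fun t p => tens_lift (fun m n => tmul m (tmul n p)) t).

Definition tens_lunit (M : lmodType F) : tens F^o M -> M :=
  tens_lift (fun (k : F^o) m => (k : F) *: m).

Definition tens_runit (M : lmodType F) : tens M F^o -> M :=
  tens_lift (fun m (k : F^o) => (k : F) *: m).

Definition tens_flip (M N : lmodType F) : tens M N -> tens N M :=
  tens_lift (fun m n => tmul n m).

End TensorProduct.

Record leibnizAlgebra (F : fieldType) := LeibnizAlgebra {
  leib_carrier :> lmodType F;
  leib_mul : leib_carrier -> leib_carrier -> leib_carrier;
  leib_mul_bilinear : bilinear_for *:%R *:%R leib_mul;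
  leib_left : forall x y z, leib_mul x (leib_mul y z) =
    leib_mul (leib_mul x y) z + leib_mul y (leib_mul x z) }.

Arguments leib_mul {F l} x y.

Section WeakBimodules.
Variables (F : fieldType) (L : leibnizAlgebra F).

Record is_weak_bimodule (M : lmodType F) (lact : L -> M -> M)
    (ract : M -> L -> M) : Prop := IsWeakBimodule {
  lact_bilinear : bilinear_for *:%R *:%R lact;
  ract_bilinear : bilinear_for *:%R *:%R ract;
  LLM : forall x y m,
    lact (leib_mul x y) m = lact x (lact y m) - lact y (lact x m);
  LML : forall x y m,
    ract (lact x m) y = lact x (ract m y) - ract m (leib_mul x y) }.

Record weakBimodule := WeakBimodule {
  wb_carrier :> lmodType F;
  lact : L -> wb_carrier -> wb_carrier;
  ract : wb_carrier -> L -> wb_carrier;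
  weak_bimoduleP : is_weak_bimodule lact ract }.

Record is_wb_hom (M N : weakBimodule) (f : M -> N) : Prop := IsWBHom {
  wb_hom_linear : linear f;
  wb_hom_lact : forall x m, f (lact x m) = lact x (f m);
  wb_hom_ract : forall m x, f (ract m x) = ract (f m) x }.

Record wb_hom (M N : weakBimodule) := WBHom {
  wb_fun :> M -> N;
  wb_homP : is_wb_hom wb_fun }.

Lemma wb_hom_eq (M N : weakBimodule) (f g : wb_hom M N) : f =1 g -> f = g.
Proof.
case: f g => [f hf] [g hg] /= /funext fg; case: g / fg hg => hg.
by rewrite (Prop_irrelevance hf hg).
Qed.

Lemma is_wb_hom_id (M : weakBimodule) : is_wb_hom (@id M).
Proof. by split. Qed.

Lemma is_wb_hom_comp (M N P : weakBimodule) (g : wb_hom N P) (f : wb_hom M N) :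
  is_wb_hom (g \o f).
Proof.
case: f g => [f [lf flL frL]] [g [lg glL grL]].
by split=> [k u v|x m|m x] /=; rewrite ?lf ?flL ?frL ?lg ?glL ?grL.
Qed.

Definition wb_id (M : weakBimodule) : wb_hom M M := WBHom (is_wb_hom_id M).

Definition wb_comp (M N P : weakBimodule) (g : wb_hom N P) (f : wb_hom M N) :
  wb_hom M P := WBHom (is_wb_hom_comp g f).

Lemma wb_comp1 (M N : weakBimodule) (f : wb_hom M N) : wb_comp (wb_id N) f = f.
Proof. exact: wb_hom_eq. Qed.

Lemma wb_1comp (M N : weakBimodule) (f : wb_hom M N) : wb_comp f (wb_id M) = f.
Proof. exact: wb_hom_eq. Qed.

Lemma wb_compA (M N P Q : weakBimodule)
    (h : wb_hom P Q) (g : wb_hom N P) (f : wb_hom M N) :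
  wb_comp h (wb_comp g f) = wb_comp (wb_comp h g) f.
Proof. exact: wb_hom_eq. Qed.

Definition weakMod : category :=
  @Category weakBimodule wb_hom wb_id wb_comp wb_comp1 wb_1comp wb_compA.

Definition tens_lact (M N : weakBimodule) (x : L) : tens M N -> tens M N :=
  tens_lift (fun m n => tmul (lact x m) n + tmul m (lact x n)).

Definition tens_ract (M N : weakBimodule) (t : tens M N) (x : L) : tens M N :=
  tens_lift (fun m n => tmul (ract m x) n + tmul m (ract n x)) t.

Definition unit_lact (x : L) (k : F^o) : F^o := 0.
Definition unit_ract (k : F^o) (x : L) : F^o := 0.

End WeakBimodules.

Arguments lact {F L w} x m.
Arguments ract {F L w} m x.

(* Main.v *)
(** A linear map out of a tensor product is determined by its values on pure
tensors, so every identity is checked there. In (LLM) for a tensor product the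
mixed terms xm * yn and ym * xn occur both in x(y(m * n)) and in y(x(m * n)),
and cancel; in (LML) the mixed terms are the same on both sides. *)

Require Import Defs.
From mathcomp Require Import all_boot all_algebra.

Set Implicit Arguments.
Unset Strict Implicit.
Unset Printing Implicit Defensive.

Import GRing.Theory.
Local Open Scope ring_scope.

(** * Consequences and closure properties of linearity, stated for bare functions *)

Section Linear.
Variables (F : fieldType) (U V W : lmodType F).

Lemma linear_fun0 (f : U -> V) : linear f -> f 0 = 0.
(* Writing [0] as [-1 *: 0 + 0] gives [f 0 = - f 0 + f 0]. *)
Proof. by move=> lf; rewrite -(addNr 0) -scaleN1r lf scaleN1r addNr. Qed.

Lemma linear_funD (f : U -> V) u v : linear f -> f (u + v) = f u + f v.
Proof. by move=> lf; rewrite -[u in LHS]scale1r lf scale1r. Qed.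

Lemma linear_funZ (f : U -> V) k u : linear f -> f (k *: u) = k *: f u.
Proof. by move=> lf; rewrite -[k *: u]addr0 lf linear_fun0 ?addr0. Qed.

Lemma linear_fun_id : linear (@id U).
Proof. by []. Qed.

Lemma linear_fun_comp (g : V -> W) (f : U -> V) :
  linear g -> linear f -> linear (fun u => g (f u)).
Proof. by move=> lg lf k u v; rewrite lf lg. Qed.

Lemma linear_fun_add (f g : U -> V) :
  linear f -> linear g -> linear (fun u => f u + g u).
Proof. by move=> lf lg k u v; rewrite lf lg scalerDr addrACA. Qed.

(** The scalars [a] and [k] can be exchanged because multiplication in [F] is commutative. *)
Lemma linear_fun_scale (f : U -> V) a : linear f -> linear (fun u => a *: f u).
Proof. by move=> lf k u v; rewrite lf scalerDr !scalerA mulrC. Qed.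

Lemma linear_fun_sub (f g : U -> V) :
  linear f -> linear g -> linear (fun u => f u - g u).
Proof. by move=> lf lg k u v; rewrite lf lg opprD scalerBr addrACA. Qed.

End Linear.

(** * Calculus of pure tensors and extensionality on triple tensor products *)

Section Tensors.
Variable F : fieldType.
Implicit Types M N P : lmodType F.

Lemma tmul_linearl M N (n : N) : linear (fun m : M => tmul m n).
Proof. exact: (tmul_bilinear M N).1. Qed.

Lemma tmul_linearr M N (m : M) : linear (tmul m : N -> tens M N).
Proof. exact: (tmul_bilinear M N).2. Qed.

Lemma tmulDl M N (m m' : M) (n : N) : tmul (m + m') n = tmul m n + tmul m' n.
Proof. exact: (linear_funD _ _ (tmul_linearl n)). Qed.

Lemma tmulDr M N (m : M) (n n' : N) : tmul m (n + n') = tmul m n + tmul m n'.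
Proof. exact: (linear_funD _ _ (tmul_linearr m)). Qed.

Lemma tmulZl M N k (m : M) (n : N) : tmul (k *: m) n = k *: tmul m n.
Proof. exact: (linear_funZ _ _ (tmul_linearl n)). Qed.

Lemma tmulZr M N k (m : M) (n : N) : tmul m (k *: n) = k *: tmul m n.
Proof. exact: (linear_funZ _ _ (tmul_linearr m)). Qed.

Lemma tmulBl M N (m m' : M) (n : N) : tmul (m - m') n = tmul m n - tmul m' n.
Proof. by rewrite tmulDl -scaleN1r tmulZl scaleN1r. Qed.

Lemma tmulBr M N (m : M) (n n' : N) : tmul m (n - n') = tmul m n - tmul m n'.
Proof. by rewrite tmulDr -scaleN1r tmulZr scaleN1r. Qed.

(** Extensionality is applied twice: once to split off [p], then, with [p] fixed, to the linear
    functions [t |-> g (tmul t p)] and [t |-> h (tmul t p)] on the inner tensor product. *)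
Lemma tens_hom_ext3l M N P (Q : lmodType F) (g h : tens (tens M N) P -> Q) :
  linear g -> linear h ->
  (forall m n p, g (tmul (tmul m n) p) = h (tmul (tmul m n) p)) -> g =1 h.
Proof.
move=> lg lh gh; apply: tens_hom_ext => // t p; move: t.
by apply: tens_hom_ext (linear_fun_comp lg (tmul_linearl p))
  (linear_fun_comp lh (tmul_linearl p)) _ => m n; exact: gh.
Qed.

(** The same double use of extensionality, now with the left factor [m] fixed first. *)
Lemma tens_hom_ext3r M N P (Q : lmodType F) (g h : tens M (tens N P) -> Q) :
  linear g -> linear h ->
  (forall m n p, g (tmul m (tmul n p)) = h (tmul m (tmul n p))) -> g =1 h.
Proof.
move=> lg lh gh; apply: tens_hom_ext => // m.
by apply: tens_hom_ext (linear_fun_comp lg (tmul_linearr m))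
  (linear_fun_comp lh (tmul_linearr m)) _ => n p; exact: gh.
Qed.

(** * Maps induced on tensor products: linearity and values on pure tensors *)

Section Map.
Variables (M M' N N' : lmodType F) (f : M -> M') (g : N -> N').
Hypotheses (lf : linear f) (lg : linear g).

Lemma tens_map_bilinear : bilinear_for *:%R *:%R (fun m n => tmul (f m) (g n)).
Proof. by split=> [n|m] k u v; rewrite ?lf ?lg ?tmul_linearl ?tmul_linearr. Qed.

Lemma tens_map_linear : linear (tens_map f g).
Proof. exact: tens_lift_linear tens_map_bilinear. Qed.

Lemma tens_mapE m n : tens_map f g (tmul m n) = tmul (f m) (g n).
Proof. exact: tens_liftE tens_map_bilinear _ _. Qed.

End Map.

Section Derivation.
Variables (M N : lmodType F) (d : M -> M) (e : N -> N).
Hypotheses (ld : linear d) (le : linear e).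

(** This is the operator that applies [d] to the first factor, plus the one that applies [e] to the
    second. Taking for [d] and [e] the left actions of a fixed [x], or the right ones, gives the
    action of [x] on a tensor product. *)
Lemma tens_der_bilinear :
  bilinear_for *:%R *:%R (fun m n => tmul (d m) n + tmul m (e n)).
Proof.
split=> [n|m].
  exact: linear_fun_add (linear_fun_comp (tmul_linearl n) ld) (tmul_linearl (e n)).
exact: linear_fun_add (tmul_linearr (d m)) (linear_fun_comp (tmul_linearr m) le).
Qed.

End Derivation.

Section Assoc.
Variables M N P : lmodType F.

Lemma tens_assoc_inner_bilinear (p : P) :
  bilinear_for *:%R *:%R (fun (m : M) (n : N) => tmul m (tmul n p)).
Proof. by split=> [n|m] k u v; rewrite ?tmul_linearl ?tmul_linearr. Qed.

(** Linearity in [t] is that of a lift. Linearity in [p] is, for fixed scalars and vectors, an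
    equality of two linear functions of [t], so it can be tested on pure tensors. *)
Lemma tens_assoc_bilinear : bilinear_for *:%R *:%R (fun (t : tens M N) (p : P) =>
  tens_lift (fun m n => tmul m (tmul n p)) t).
Proof.
split=> [p|t]; first exact: tens_lift_linear (tens_assoc_inner_bilinear p).
move=> k p q; move: t; apply: tens_hom_ext.
- exact: tens_lift_linear (tens_assoc_inner_bilinear _).
- apply: linear_fun_add; last exact: tens_lift_linear (tens_assoc_inner_bilinear _).
  by apply: linear_fun_scale; apply: tens_lift_linear (tens_assoc_inner_bilinear _).
- move=> m n; rewrite !(tens_liftE (tens_assoc_inner_bilinear _)).
  by rewrite !tmul_linearr.
Qed.

Lemma tens_assoc_linear : linear (@tens_assoc F M N P).
Proof. exact: tens_lift_linear tens_assoc_bilinear. Qed.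

Lemma tens_assocE m n p :
  tens_assoc (tmul (tmul m n) p) = tmul m (tmul n p) :> tens M (tens N P).
Proof.
rewrite /tens_assoc (tens_liftE tens_assoc_bilinear).
exact: (tens_liftE (tens_assoc_inner_bilinear _)).
Qed.

End Assoc.

Section UnitFlip.
Variables M N : lmodType F.

Lemma tens_lunit_bilinear :
  bilinear_for *:%R *:%R (fun (k : F^o) (m : M) => (k : F) *: m).
Proof.
split=> [m k u v|a]; first by rewrite /= scalerDl scalerA.
exact: linear_fun_scale a (@linear_fun_id _ M).
Qed.

Lemma tens_lunit_linear : linear (@tens_lunit F M).
Proof. exact: tens_lift_linear tens_lunit_bilinear. Qed.

Lemma tens_lunitE (k : F^o) (m : M) : tens_lunit (tmul k m) = (k : F) *: m.
Proof. exact: tens_liftE tens_lunit_bilinear _ _. Qed.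

Lemma tens_runit_bilinear :
  bilinear_for *:%R *:%R (fun (m : M) (k : F^o) => (k : F) *: m).
Proof.
by split=> [a|m];
  [exact: tens_lunit_bilinear.2|exact: tens_lunit_bilinear.1].
Qed.

Lemma tens_runit_linear : linear (@tens_runit F M).
Proof. exact: tens_lift_linear tens_runit_bilinear. Qed.

Lemma tens_runitE (m : M) (k : F^o) : tens_runit (tmul m k) = (k : F) *: m.
Proof. exact: tens_liftE tens_runit_bilinear _ _. Qed.

Lemma tens_flip_bilinear :
  bilinear_for *:%R *:%R (fun (m : M) (n : N) => tmul n m).
Proof. by split=> [n|m]; [exact: tmul_linearr|exact: tmul_linearl]. Qed.

Lemma tens_flip_linear : linear (@tens_flip F M N).
Proof. exact: tens_lift_linear tens_flip_bilinear. Qed.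

Lemma tens_flipE (m : M) (n : N) : tens_flip (tmul m n) = tmul n m.
Proof. exact: tens_liftE tens_flip_bilinear _ _. Qed.

End UnitFlip.
End Tensors.

(** * Linearity of the actions and morphisms of weak bimodules *)

Section WeakBimodules.
Variables (F : fieldType) (L : leibnizAlgebra F).
Implicit Types M N P Q : weakBimodule L.

Lemma lact_linear M x : linear (lact x : M -> M).
Proof. by case: (weak_bimoduleP M) => -[]. Qed.

Lemma lact_linearl M (m : M) : linear (fun x : L => lact x m).
Proof. by case: (weak_bimoduleP M) => -[]. Qed.

Lemma ract_linear M (x : L) : linear (fun m : M => ract m x).
Proof. by case: (weak_bimoduleP M) => _ []. Qed.

Lemma ract_linearr M (m : M) : linear (ract m : L -> M).
Proof. by case: (weak_bimoduleP M) => _ []. Qed.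

Lemma wb_fun_linear M N (f : wb_hom M N) : linear f.
Proof. exact: wb_hom_linear (wb_homP f). Qed.

(** * The tensor product and the unit object as weak bimodules *)

Lemma tens_lact_linear M N x : linear (@tens_lact F L M N x).
Proof.
exact: tens_lift_linear (tens_der_bilinear (lact_linear x) (lact_linear x)).
Qed.

Lemma tens_lactE M N x (m : M) (n : N) :
  tens_lact x (tmul m n) = tmul (lact x m) n + tmul m (lact x n).
Proof.
exact: (tens_liftE (tens_der_bilinear (lact_linear x) (lact_linear x))).
Qed.

Lemma tens_ract_linear M N x : linear (fun t => @tens_ract F L M N t x).
Proof.
exact: tens_lift_linear (tens_der_bilinear (ract_linear x) (ract_linear x)).
Qed.

Lemma tens_ractE M N x (m : M) (n : N) :
  tens_ract (tmul m n) x = tmul (ract m x) n + tmul m (ract n x).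
Proof.
exact: (tens_liftE (tens_der_bilinear (ract_linear x) (ract_linear x))).
Qed.

Lemma tens_lactD M N x (t u : tens M N) :
  tens_lact x (t + u) = tens_lact x t + tens_lact x u.
Proof. exact: linear_funD (tens_lact_linear x). Qed.

Lemma tens_ractD M N x (t u : tens M N) :
  tens_ract (t + u) x = tens_ract t x + tens_ract u x.
Proof. exact: linear_funD (tens_ract_linear x). Qed.

Lemma tens_weak_bimodule M N :
  is_weak_bimodule (@tens_lact F L M N) (@tens_ract F L M N).
Proof.
have lL := @tens_lact_linear M N; have lR := @tens_ract_linear M N.
split.
(* For linearity in the algebra element, both sides are linear in [t], which may therefore be taken
   pure. *)
- split=> [t k x y|x]; last exact: lL.
  move: t; apply: tens_hom_ext (lL _) _ _.
    exact: linear_fun_add (linear_fun_scale k (lL x)) (lL y).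
  move=> m n; rewrite !tens_lactE !lact_linearl tmul_linearl tmul_linearr.
  by rewrite /= scalerDr addrACA.
- split=> [x|t k x y]; first exact: lR.
  move: t; apply: tens_hom_ext (lR _) _ _.
    exact: linear_fun_add (linear_fun_scale k (lR x)) (lR y).
  move=> m n; rewrite !tens_ractE !ract_linearr tmul_linearl tmul_linearr.
  by rewrite /= scalerDr addrACA.
- move=> x y; apply: tens_hom_ext (lL _) _ _.
    exact: linear_fun_sub (linear_fun_comp (lL x) (lL y))
      (linear_fun_comp (lL y) (lL x)).
  move=> m n; rewrite !(tens_lactE, tens_lactD) !(LLM (weak_bimoduleP _)).
  (* The mixed terms are [tmul (lact y m) (lact x n)] and [tmul (lact x m) (lact y n)]. Exchanging
     them in the first sum puts each opposite its own negative, so that regrouping factor by factor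
     makes them cancel. *)
  rewrite tmulBl tmulBr [X in _ = X - _]addrACA opprD.
  rewrite [in X in _ = X](addrACA _ _ (- _)) !opprD.
  rewrite [X in _ = X + _](addrACA _ _ (- _)) subrr addr0.
  by rewrite [X in _ = _ + X](addrACA _ _ (- _)) subrr add0r.
- move=> x y; apply: tens_hom_ext.
  + exact: linear_fun_comp (lR y) (lL x).
  + exact: linear_fun_sub (linear_fun_comp (lL x) (lR y)) (lR _).
  move=> m n; rewrite !(tens_lactE, tens_ractE, tens_lactD, tens_ractD).
  rewrite !(LML (weak_bimoduleP _)) tmulBl tmulBr.
  (* Nothing cancels here: both sides are brought to the same grouping, one bracket with the terms
     where (LML) is used in [M] and one with those where it is used in [N], each carrying one mixed
     term. *)
  rewrite [X in _ = X - _]addrACA opprD.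
  by rewrite [X in X + _ = _]addrAC [X in _ + X = _]addrA [RHS]addrACA.
Qed.

Lemma unit_weak_bimodule : is_weak_bimodule (@unit_lact F L) (@unit_ract F L).
Proof.
(* Bilinearity of a zero action amounts to this identity in either argument. *)
have Z k : 0 = k *: 0 + 0 :> F^o by rewrite scaler0 addr0.
split.
- by split=> ? k ? ?; apply: Z.
- by split=> ? k ? ?; apply: Z.
- by move=> x y k; rewrite /unit_lact subr0.
- by move=> x y k; rewrite /unit_lact /unit_ract subr0.
Qed.

(** * Compatibility of the vector space constraints with both actions *)

Local Notation T M N := (WeakBimodule (tens_weak_bimodule M N)).
Local Notation I := (WeakBimodule unit_weak_bimodule).

(** Acting before or after the map gives linear functions of the tensor. On a pure tensor they agree
    in each summand because [f] and [g] commute with the actions. *)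
Lemma is_wb_hom_tens_map M M' N N' (f : wb_hom M M') (g : wb_hom N N') :
  @is_wb_hom F L (T M N) (T M' N') (tens_map f g).
Proof.
have lfg := tens_map_linear (wb_fun_linear f) (wb_fun_linear g).
have fgE := tens_mapE (wb_fun_linear f) (wb_fun_linear g).
split=> /= [|x|t x]; first exact: lfg.
  apply: tens_hom_ext.
  - exact: linear_fun_comp lfg (tens_lact_linear x).
  - exact: linear_fun_comp (tens_lact_linear x) lfg.
  move=> m n; rewrite tens_lactE (linear_funD _ _ lfg) !fgE tens_lactE.
  by rewrite !(wb_hom_lact (wb_homP _)).
move: t; apply: tens_hom_ext.
- exact: linear_fun_comp lfg (tens_ract_linear x).
- exact: linear_fun_comp (tens_ract_linear x) lfg.
move=> m n; rewrite tens_ractE (linear_funD _ _ lfg) !fgE tens_ractE.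
by rewrite !(wb_hom_ract (wb_homP _)).
Qed.

(** On a pure triple tensor both sides consist of the same three terms, one for each factor on which
    [x] acts; only the bracketing of the sum differs. *)
Lemma is_wb_hom_tens_assoc M N P :
  @is_wb_hom F L (T (T M N) P) (T M (T N P)) (@tens_assoc F M N P).
Proof.
have la := @tens_assoc_linear F M N P.
split=> /= [|x|t x]; first exact: la.
  apply: tens_hom_ext3l.
  - exact: linear_fun_comp la (@tens_lact_linear (T M N) P x).
  - exact: linear_fun_comp (@tens_lact_linear M (T N P) x) la.
  move=> m n p; rewrite (@tens_lactE (T M N) P) tens_assocE (@tens_lactE M (T N P)).
  rewrite /= !tens_lactE tmulDl tmulDr !(linear_funD _ _ la) !tens_assocE.
  by rewrite addrA.
move: t; apply: tens_hom_ext3l.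
- exact: linear_fun_comp la (@tens_ract_linear (T M N) P x).
- exact: linear_fun_comp (@tens_ract_linear M (T N P) x) la.
move=> m n p; rewrite (@tens_ractE (T M N) P) tens_assocE (@tens_ractE M (T N P)).
rewrite /= !tens_ractE tmulDl tmulDr !(linear_funD _ _ la) !tens_assocE.
by rewrite addrA.
Qed.

(** The zero action on the unit kills the first summand of the action on a pure tensor; for the
    other, the scalar [k] passes through the action of [x] on [M] by linearity. *)
Lemma is_wb_hom_tens_lunit M : @is_wb_hom F L (T I M) M (@tens_lunit F M).
Proof.
have lu := @tens_lunit_linear F M.
split=> /= [|x|t x]; first exact: lu.
  apply: tens_hom_ext.
  - exact: linear_fun_comp lu (@tens_lact_linear I M x).
  - exact: linear_fun_comp (lact_linear x) lu.
  move=> k m; rewrite (@tens_lactE I M) (linear_funD _ _ lu) !tens_lunitE /=.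
  by rewrite scale0r add0r (linear_funZ _ _ (lact_linear x)).
move: t; apply: tens_hom_ext.
- exact: linear_fun_comp lu (@tens_ract_linear I M x).
- exact: linear_fun_comp (ract_linear x) lu.
move=> k m; rewrite (@tens_ractE I M) (linear_funD _ _ lu) !tens_lunitE /=.
by rewrite scale0r add0r (linear_funZ _ _ (ract_linear x)).
Qed.

(** The flip exchanges the two summands of the action, which is harmless since addition is
    commutative. *)
Lemma is_wb_hom_tens_flip M N : @is_wb_hom F L (T M N) (T N M) (@tens_flip F M N).
Proof.
have lf := @tens_flip_linear F M N.
split=> /= [|x|t x]; first exact: lf.
  apply: tens_hom_ext.
  - exact: linear_fun_comp lf (tens_lact_linear x).
  - exact: linear_fun_comp (tens_lact_linear x) lf.
  by move=> m n; rewrite tens_lactE (linear_funD _ _ lf) !tens_flipE tens_lactE addrC.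
move: t; apply: tens_hom_ext.
- exact: linear_fun_comp lf (tens_ract_linear x).
- exact: linear_fun_comp (tens_ract_linear x) lf.
by move=> m n; rewrite tens_ractE (linear_funD _ _ lf) !tens_flipE tens_ractE addrC.
Qed.

Lemma is_wb_hom_tens_runit M : @is_wb_hom F L (T M I) M (@tens_runit F M).
Proof.
have ru := @tens_runit_linear F M.
split=> /= [|x|t x]; first exact: ru.
  apply: tens_hom_ext.
  - exact: linear_fun_comp ru (@tens_lact_linear M I x).
  - exact: linear_fun_comp (lact_linear x) ru.
  move=> m k; rewrite (@tens_lactE M I) (linear_funD _ _ ru) !tens_runitE /=.
  by rewrite scale0r addr0 (linear_funZ _ _ (lact_linear x)).
move: t; apply: tens_hom_ext.
- exact: linear_fun_comp ru (@tens_ract_linear M I x).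
- exact: linear_fun_comp (ract_linear x) ru.
move=> m k; rewrite (@tens_ractE M I) (linear_funD _ _ ru) !tens_runitE /=.
by rewrite scale0r addr0 (linear_funZ _ _ (ract_linear x)).
Qed.

(** * Equality of morphisms out of iterated tensor products *)

Lemma wb_hom_tens_ext M N P (f g : wb_hom (T M N) P) :
  (forall m n, f (tmul m n) = g (tmul m n)) -> f = g.
Proof.
move=> fg; apply: wb_hom_eq.
exact: tens_hom_ext (wb_fun_linear f) (wb_fun_linear g) fg.
Qed.

Lemma wb_hom_tens_ext3l M N P Q (f g : wb_hom (T (T M N) P) Q) :
  (forall m n p, f (tmul (tmul m n) p) = g (tmul (tmul m n) p)) -> f = g.
Proof.
move=> fg; apply: wb_hom_eq.
exact: tens_hom_ext3l (wb_fun_linear f) (wb_fun_linear g) fg.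
Qed.

Lemma wb_hom_tens_ext3r M N P Q (f g : wb_hom (T M (T N P)) Q) :
  (forall m n p, f (tmul m (tmul n p)) = g (tmul m (tmul n p))) -> f = g.
Proof.
move=> fg; apply: wb_hom_eq.
exact: tens_hom_ext3r (wb_fun_linear f) (wb_fun_linear g) fg.
Qed.

(** Needed for the pentagon. With [q] fixed, both morphisms become linear functions on a triple
    tensor product. *)
Lemma wb_hom_tens_ext4 M N P Q (R : weakBimodule L)
    (f g : wb_hom (T (T (T M N) P) Q) R) :
  (forall m n p q, f (tmul (tmul (tmul m n) p) q) =
                   g (tmul (tmul (tmul m n) p) q)) -> f = g.
Proof.
move=> fg; apply: wb_hom_tens_ext => t q; move: t.
by apply: tens_hom_ext3l (linear_fun_comp (wb_fun_linear f) (tmul_linearl q))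
  (linear_fun_comp (wb_fun_linear g) (tmul_linearl q)) _ => m n p; exact: fg.
Qed.

(** * Structure morphisms and their values on pure tensors *)

Definition wb_tens_map M M' N N' (f : wb_hom M M') (g : wb_hom N N') :
  wb_hom (T M N) (T M' N') := WBHom (is_wb_hom_tens_map f g).

Definition wb_assoc M N P : wb_hom (T (T M N) P) (T M (T N P)) :=
  WBHom (is_wb_hom_tens_assoc M N P).

Definition wb_lunit M : wb_hom (T I M) M := WBHom (is_wb_hom_tens_lunit M).

Definition wb_runit M : wb_hom (T M I) M := WBHom (is_wb_hom_tens_runit M).

Definition wb_flip M N : wb_hom (T M N) (T N M) := WBHom (is_wb_hom_tens_flip M N).

Lemma wb_tens_mapE M M' N N' (f : wb_hom M M') (g : wb_hom N N') m n :
  wb_tens_map f g (tmul m n) = tmul (f m) (g n).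
Proof. exact: tens_mapE (wb_fun_linear f) (wb_fun_linear g) m n. Qed.

Lemma wb_assocE M N P m n p :
  wb_assoc M N P (tmul (tmul m n) p) = tmul m (tmul n p).
Proof. exact: tens_assocE. Qed.

Lemma wb_lunitE M (k : F) m : wb_lunit M (tmul (k : F^o) m) = k *: m.
Proof. exact: tens_lunitE. Qed.

Lemma wb_runitE M m (k : F) : wb_runit M (tmul m (k : F^o)) = k *: m.
Proof. exact: tens_runitE. Qed.

Lemma wb_flipE M N m n : wb_flip M N (tmul m n) = tmul n m.
Proof. exact: tens_flipE. Qed.

Lemma wb_compE M N P (g : wb_hom N P) (f : wb_hom M N) m :
  wb_comp g f m = g (f m).
Proof. by []. Qed.

(** This map is the inverse of the left unit constraint. The actions on the unit are zero, so in the
    action on [tmul 1 m] the summand with first factor [0] vanishes and only the action on [m]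
    remains. *)
Lemma is_wb_hom_tens_unitl M : @is_wb_hom F L M (T I M) (tmul (1 : F^o)).
Proof.
split=> [|x m|m x]; first exact: tmul_linearr.
  rewrite [RHS](@tens_lactE I M) /= /unit_lact.
  by rewrite [X in X + _](linear_fun0 (tmul_linearl _)) add0r.
rewrite [RHS](@tens_ractE I M) /= /unit_ract.
by rewrite [X in X + _](linear_fun0 (tmul_linearl _)) add0r.
Qed.

(** * The symmetric monoidal axioms *)

Definition weakMod_monoidal_data := @SymMonoidalData (weakMod L) (fun M N => T M N)
  wb_tens_map I wb_assoc wb_lunit wb_runit wb_flip.

(** Rewriting with these equations evaluates composites of structure morphisms on pure tensors,
    which settles most axioms outright. *)
Definition wbE := (wb_compE, wb_tens_mapE, wb_assocE, wb_lunitE, wb_runitE, wb_flipE).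

Lemma weakMod_symmetric_monoidal : is_symmetric_monoidal weakMod_monoidal_data.
Proof.
split=> /=.
- by move=> M N; apply: wb_hom_tens_ext => m n; rewrite !wbE.
- by move=> *; apply: wb_hom_tens_ext => m n; rewrite !wbE.
- by move=> *; apply: wb_hom_tens_ext3l => m n p; rewrite !wbE.
- move=> M M' f; apply: (@wb_hom_tens_ext I M) => k m; rewrite !wbE.
  (* Naturality of the unit constraint is homogeneity of [f]. *)
  by rewrite (linear_funZ _ _ (wb_fun_linear f)).
- move=> M M' f; apply: (@wb_hom_tens_ext M I) => m k; rewrite !wbE.
  by rewrite (linear_funZ _ _ (wb_fun_linear f)).
- by move=> *; apply: wb_hom_tens_ext => m n; rewrite !wbE.
- move=> M N P.
  (* Up to flips, the inverse associator is a cyclic rotation by associators. *)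
  exists (wb_comp (wb_flip P (T M N)) (wb_comp (wb_assoc P M N)
    (wb_comp (wb_flip N (T P M)) (wb_comp (wb_assoc N P M) (wb_flip M (T N P)))))).
  split.
    by apply: wb_hom_tens_ext3l => m n p; rewrite !wbE.
  by apply: wb_hom_tens_ext3r => m n p; rewrite !wbE.
- move=> M; exists (WBHom (is_wb_hom_tens_unitl M)); split.
    apply: (@wb_hom_tens_ext I M) => k m; rewrite !wbE /=.
    (* The scalar crosses the tensor sign: [tmul 1 (k *: m) = tmul (k *: 1) m]. In [F^o] scaling is
       multiplication, so [k *: 1] is [k]. *)
    by rewrite tmulZr -tmulZl [_ *: _]mulr1.
  by apply: wb_hom_eq => m; rewrite !wbE scale1r.
(* Flipping the inverse of the left unit constraint gives [m |-> tmul m 1]. *)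
- move=> M; exists (wb_comp (wb_flip I M) (WBHom (is_wb_hom_tens_unitl M))); split.
    apply: (@wb_hom_tens_ext M I) => m k; rewrite !wbE /=.
    by rewrite tmulZl -tmulZr [_ *: _]mulr1.
  by apply: wb_hom_eq => m; rewrite !wbE scale1r.
- by move=> *; apply: wb_hom_tens_ext4 => m n p q; rewrite !wbE.
- move=> M N; apply: (@wb_hom_tens_ext3l M I N) => m k n; rewrite !wbE /=.
  (* The triangle compares [tmul m (k *: n)] with [tmul (k *: m) n]; both equal [k *: tmul m n]. *)
  by rewrite tmulZr tmulZl.
- by move=> *; apply: wb_hom_tens_ext3l => m n p; rewrite !wbE.
- by move=> *; apply: wb_hom_tens_ext => m n; rewrite !wbE.
Qed.

End WeakBimodules.

Theorem theorem3p15 (F : fieldType) (L : leibnizAlgebra F) :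
  exists (tensP : forall M N : weakBimodule L,
            is_weak_bimodule (@tens_lact F L M N) (@tens_ract F L M N))
         (unitP : is_weak_bimodule (@unit_lact F L) (@unit_ract F L)),
  let T (M N : weakBimodule L) : weakBimodule L := WeakBimodule (tensP M N) in
  let I : weakBimodule L := WeakBimodule unitP in
  exists (mapP : forall (M M' N N' : weakBimodule L)
                        (f : wb_hom M M') (g : wb_hom N N'),
            @is_wb_hom F L (T M N) (T M' N') (tens_map f g))
         (assocP : forall M N P : weakBimodule L,
            @is_wb_hom F L (T (T M N) P) (T M (T N P)) (@tens_assoc F M N P))
         (lunitP : forall M : weakBimodule L,
            @is_wb_hom F L (T I M) M (@tens_lunit F M))
         (runitP : forall M : weakBimodule L,
            @is_wb_hom F L (T M I) M (@tens_runit F M))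
         (flipP : forall M N : weakBimodule L,
            @is_wb_hom F L (T M N) (T N M) (@tens_flip F M N)),
  is_symmetric_monoidal
    (@SymMonoidalData (weakMod L) T
       (fun M M' N N' f g => WBHom (mapP M M' N N' f g))
       I
       (fun M N P => WBHom (assocP M N P))
       (fun M => WBHom (lunitP M))
       (fun M => WBHom (runitP M))
       (fun M N => WBHom (flipP M N))).
Proof.
(* All existential witnesses are proofs: the objects and maps themselves are fixed by the explicit
   vector space formulas. *)
exists (@tens_weak_bimodule F L), (unit_weak_bimodule L) => /=.
exists (@is_wb_hom_tens_map F L), (@is_wb_hom_tens_assoc F L),
  (@is_wb_hom_tens_lunit F L), (@is_wb_hom_tens_runit F L),
  (@is_wb_hom_tens_flip F L).
exact: weakMod_symmetric_monoidal.
Qed.
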